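(* Let $n\ge 1$ be an integer and let $X$ be an $S(n)$-closed $S(n)$-space. Then $X$ is weakly $S(n)$-closed.
   Context: All neighborhoods are open; $\overline{M}=\mathrm{cl}\,M$ is the closure. $\theta^n$-closure ($n\ge1$): $x\notin \mathrm{cl}_{\theta^n}M$ iff there are open neighborhoods $U_1,\dots,U_n$ of $x$ with $\mathrm{cl}\,U_i\subseteq U_{i+1}$ for $i=1,\dots,n-1$ and $\mathrm{cl}\,U_n\cap M=\emptyset$. $X$ is an $S(n)$-space if $x\notin\mathrm{cl}_{\theta^n}\{y\}$ for any two distinct points $x,y\in X$. An $S(n)$-space is $S(n)$-closed if it is closed in every $S(n)$-space containing it as a subspace. An $n$-hull of a point $x$ is a neighborhood $U$ of $x$ for which there are neighborhoods $U_1,\dots,U_n=U$ of $x$ with $\mathrm{cl}\,U_i\subseteq U_{i+1}$ for $i=1,\dots,n-1$. A point $x$ is a $\theta(n)$-complete accumulation point of an infinite set $F$ if $|F\cap\overline U|=|F|$ for every $n$-hull $U$ of $x$. $X$ is weakly $S(n)$-closed if every infinite subset of $X$ whose cardinality is a regular cardinal has a $\theta(n)$-complete accumulation point in $X$. *)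

(* Defs.v *)
From mathcomp Require Import all_boot all_order all_algebra.
From mathcomp Require Import all_classical all_reals all_analysis.

Set Implicit Arguments.
Unset Strict Implicit.
Unset Printing Implicit Defensive.

Local Open Scope classical_set_scope.
Local Open Scope card_scope.

(* [U 1, ..., U n] are open neighborhoods of [x] with [closure (U i)] contained
   in [U i.+1]; the values of [U] outside of 1..n are irrelevant. *)
Definition nbhs_chain (n : nat) (X : topologicalType) (x : X)
    (U : nat -> set X) : Prop :=
  (forall i, 1 <= i <= n -> open_nbhs x (U i)) /\
  (forall i, 1 <= i < n -> closure (U i) `<=` U i.+1).

(* Meaningful for [1 <= n] only, like all the notions below built on chains. *)
Definition theta_closure (n : nat) (X : topologicalType) (M : set X) : set X :=
  [set x | ~ exists U : nat -> set X,
             nbhs_chain n x U /\ closure (U n) `&` M = set0].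

Definition S_space (n : nat) (X : topologicalType) : Prop :=
  forall x y : X, x <> y -> ~ theta_closure n [set y] x.

Definition topological_embedding (X Y : topologicalType) (f : X -> Y) : Prop :=
  injective f /\
  (forall A : set X, open A <-> exists2 B : set Y, open B & f @^-1` B = A).

(* The S(n)-spaces containing [X] as a subspace are represented by the
   embeddings of [X] into S(n)-spaces. *)
Definition S_closed (n : nat) (X : topologicalType) : Prop :=
  forall (Y : topologicalType) (f : X -> Y),
    S_space n Y -> topological_embedding f -> closed (range f).

Definition n_hull (n : nat) (X : topologicalType) (x : X) (V : set X) : Prop :=
  exists U : nat -> set X, nbhs_chain n x U /\ U n = V.

Definition theta_complete_accumulation_point (n : nat) (X : topologicalType)
    (F : set X) (x : X) : Prop :=
  forall V : set X, n_hull n x V -> (F `&` closure V) #= F.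

Definition card_lt (T U : Type) (A : set T) (B : set U) : Prop :=
  A #<= B /\ ~ (B #<= A).

(* An infinite cardinal is regular when a union of fewer than |F| sets, each of
   cardinality less than |F|, always has cardinality less than |F|. *)
Definition regular_card (T : Type) (F : set T) : Prop :=
  infinite_set F /\
  forall (I U : Type) (D : set I) (G : I -> set U),
    card_lt D F -> (forall i, D i -> card_lt (G i) F) ->
    card_lt (\bigcup_(i in D) G i) F.

Definition weakly_S_closed (n : nat) (X : topologicalType) : Prop :=
  forall F : set X, infinite_set F -> regular_card F ->
    exists x : X, theta_complete_accumulation_point n F x.

(* Main.v *)
Require Import Defs.
From HB Require Import structures.
From mathcomp Require Import all_boot all_order all_algebra.
From mathcomp Require Import all_classical all_reals all_analysis.

(** Suppose [F] has no theta(n)-complete accumulation point. Add a point [None]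
    to [X] whose neighborhoods trace on [X] the sets [W] such that [F `\` W] has
    smaller cardinality than [F]; they form a filter [G]. Every [x] in [X] has a
    chain [U 1, ..., U n] with [~` closure (U n)] in [G]. Intersecting any chain
    at [x] with this one keeps closures away from [None], and the complements of
    the [closure (U i)], in reverse order, form a chain at [None]. So the
    extension is an S(n)-space, and [X] is not closed in it. *)

Set Implicit Arguments.
Unset Strict Implicit.
Unset Printing Implicit Defensive.

Local Open Scope classical_set_scope.
Local Open Scope card_scope.

Lemma nbhs_chain_sub (n : nat) (X : topologicalType) (x : X) (U : nat -> set X)
    (i : nat) : nbhs_chain n x U -> 1 <= i <= n -> U i `<=` U n.
Proof.
case=> _ clU /andP[i1 ilen].
have: forall k, i + k <= n -> U i `<=` U (i + k).
  elim=> [|k IHk]; first by rewrite addn0 => _ y.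
  rewrite addnS => ikn; apply: subset_trans (IHk (ltnW ikn)) _.
  apply: subset_trans (@subset_closure _ _) (clU _ _).
  by rewrite ikn andbT (leq_trans i1) ?leq_addr.
by move/(_ (n - i)); rewrite subnKC //; apply; exact: leqnn.
Qed.

Lemma nbhs_chainI (n : nat) (X : topologicalType) (x : X)
    (U V : nat -> set X) : nbhs_chain n x U -> nbhs_chain n x V ->
  nbhs_chain n x (fun i => U i `&` V i).
Proof.
move=> [oU cU] [oV cV]; split=> i ni.
  by apply: open_nbhsI; [apply: oU | apply: oV].
apply: subset_trans (@closureI _ _ _) _.
by apply: setISS; [apply: cU | apply: cV].
Qed.

(* The proof that [G] is a filter is an argument so that the topology below can
   be attached to the type. *)
Definition filter_extension (X : topologicalType) (G : set_system X)
  of Filter G : Type := option X.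

(** Only sets containing [None] are constrained by [G], so [X] sits in the extension as an open
    subspace. *)
Definition extension_open (X : topologicalType) (G : set_system X)
    (O : set (option X)) : Prop :=
  open (Some @^-1` O) /\ (O None -> G (Some @^-1` O)).

Lemma extension_openT (X : topologicalType) (G : set_system X) :
  Filter G -> extension_open G setT.
Proof. by move=> FG; split; [exact: openT | move=> _; exact: filterT]. Qed.

Lemma extension_openI (X : topologicalType) (G : set_system X) :
  Filter G -> setI_closed (extension_open G).
Proof.
move=> FG A B [oA GA] [oB GB]; split; first exact: openI.
by move=> [/GA ? /GB ?]; exact: filterI.
Qed.

Lemma extension_open_bigU (X : topologicalType) (G : set_system X) :
  Filter G -> forall (I : Type) (f : I -> set (option X)),
  (forall i, extension_open G (f i)) -> extension_open G (\bigcup_i f i).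
Proof.
move=> FG I f fG; split.
  by rewrite preimage_bigcup; apply: bigcup_open => i _; case: (fG i).
move=> [i _ fi]; case: (fG i) => _ /(_ fi); apply: filterS => x fix_.
by exists i.
Qed.

HB.instance Definition _ (X : topologicalType) (G : set_system X)
  (FG : Filter G) := Choice.copy (filter_extension FG) (option X).

HB.instance Definition _ (X : topologicalType) (G : set_system X)
    (FG : Filter G) :=
  isOpenTopological.Build (filter_extension FG) (extension_openT FG)
    (extension_openI FG) (extension_open_bigU FG).

Definition extension_inj (X : topologicalType) (G : set_system X)
  (FG : Filter G) : X -> filter_extension FG := Some.

Lemma extension_openE (X : topologicalType) (G : set_system X)
    (FG : Filter G) (O : set (filter_extension FG)) :
  open O = (open (extension_inj FG @^-1` O) /\
            (O None -> G (extension_inj FG @^-1` O))).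
Proof. by []. Qed.

Lemma preimage_extension_inj (X : topologicalType) (G : set_system X)
    (FG : Filter G) (A : set X) :
  extension_inj FG @^-1` (extension_inj FG @` A) = A.
Proof.
by apply/seteqP; split=> [x [y Ay [<-]]//|x Ax]; exists x.
Qed.

Lemma open_extension_inj (X : topologicalType) (G : set_system X)
    (FG : Filter G) (U : set X) : open U -> open (extension_inj FG @` U).
Proof.
move=> oU; rewrite extension_openE; split; last by case.
by rewrite preimage_extension_inj.
Qed.

Lemma closed_extension_inj (X : topologicalType) (G : set_system X)
    (FG : Filter G) (C : set X) :
  closed C -> G (~` C) -> closed (extension_inj FG @` C).
Proof.
move=> cC GC; rewrite -openC extension_openE.
rewrite (_ : extension_inj FG @^-1` _ = ~` C); first by split; rewrite ?openC.
by rewrite -[in RHS](preimage_extension_inj FG C).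
Qed.

Lemma closure_extension_inj (X : topologicalType) (G : set_system X)
    (FG : Filter G) (A : set X) : G (~` closure A) ->
  closure (extension_inj FG @` A) `<=` extension_inj FG @` closure A.
Proof.
move=> GA; rewrite [X in _ `<=` X](closure_id _).1.
  by apply: closureS; apply: image_subset; apply: subset_closure.
by apply: closed_extension_inj => //; exact: closed_closure.
Qed.

Lemma extension_inj_interior (X : topologicalType) (G : set_system X)
    (FG : Filter G) (U : set X) : open U ->
  extension_inj FG @` U `<=` (extension_inj FG @` closure U)°.
Proof.
move=> oU; rewrite -[X in X `<=` _](interior_id _).1.
  by apply: interiorS; apply: image_subset; exact: subset_closure.
exact: open_extension_inj.
Qed.

Lemma extension_embedding (X : topologicalType) (G : set_system X)
    (FG : Filter G) : topological_embedding (extension_inj FG).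
Proof.
split=> [x y [] //|A]; split=> [oA|[B oB <-]]; last by case: oB.
exists (extension_inj FG @` A); first exact: open_extension_inj.
exact: preimage_extension_inj.
Qed.

(** The complement of the range is the singleton of [None], whose trace on [X] is empty. *)
Lemma range_extension_not_closed (X : topologicalType) (G : set_system X)
    (FG : Filter G) : ~ G set0 -> ~ closed (range (extension_inj FG)).
Proof.
move=> G0; rewrite -openC extension_openE => -[_].
have -> : extension_inj FG @^-1` (~` range (extension_inj FG)) = set0.
  by apply/seteqP; split=> x //; apply; exists x.
by move=> GN; apply: G0; apply: GN => -[].
Qed.

Lemma nbhs_chain_extension (n : nat) (X : topologicalType) (G : set_system X)
    (FG : Filter G) (x : X) (U : nat -> set X) :
  nbhs_chain n x U -> G (~` closure (U n)) ->
  nbhs_chain n (extension_inj FG x) (fun i => extension_inj FG @` U i).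
Proof.
move=> chU GU; have [oU cU] := chU; split=> i ni.
  have [oUi Uix] := oU i ni; split; first exact: open_extension_inj.
  by exists x.
(* No closure gains the point [None]: each [closure (U i)] lies in [closure (U n)], whose complement
   is in [G]. *)
apply: subset_trans (image_subset (extension_inj FG) (cU _ ni)).
apply: closure_extension_inj; apply: filterS GU.
apply: subsetC; apply: closureS; apply: (nbhs_chain_sub chU).
by case/andP: ni => -> /ltnW.
Qed.

(** The index [n.+1 - i] reverses 1..n. Taking complements turns the inclusion of
    [closure (U (n - i))] in the open set [U (n.+1 - i)] into the chain condition at [None]. *)
Lemma nbhs_chain_None (n : nat) (X : topologicalType) (G : set_system X)
    (FG : Filter G) (x : X) (U : nat -> set X) :
  nbhs_chain n x U -> G (~` closure (U n)) ->
  nbhs_chain n (None : filter_extension FG)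
    (fun i => ~` (extension_inj FG @` closure (U (n.+1 - i)))).
Proof.
move=> chU GU; have [oU cU] := chU; split=> i /andP[i1 ilen].
  split; last by case.
  rewrite openC; apply: closed_extension_inj; first exact: closed_closure.
  apply: filterS GU.
  apply: subsetC; apply: closureS; apply: (nbhs_chain_sub chU).
  by rewrite subn_gt0 ltnS ilen leq_subLR -add1n leq_add2r.
(* The closure of a complement is the complement of the interior, so the image of
   [closure (U (n - i))] has to lie in the interior of the image of [closure (U (n.+1 - i))]. *)
rewrite closure_setC; apply: subsetC => y [z clz <-].
have oUi : open (U (n.+1 - i)).
  apply: (oU _ _).1.
  by rewrite subn_gt0 ltnS (ltnW ilen) leq_subLR -add1n leq_add2r.
apply: extension_inj_interior => //; exists z => //.
rewrite subSn ?(ltnW ilen) //; apply: (cU (n - i)); last exact: clz.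
by rewrite subn_gt0 ilen ltn_subrL i1 (leq_trans i1 (ltnW ilen)).
Qed.

Lemma extension_S_space (n : nat) (X : topologicalType) (G : set_system X)
    (FG : Filter G) : 1 <= n -> S_space n X ->
  (forall x : X, exists2 U : nat -> set X,
     nbhs_chain n x U & G (~` closure (U n))) ->
  S_space n (filter_extension FG).
Proof.
move=> n1 hS sepG [x|] [y|] xy; apply.
(* For two points of [X], [U] separates [x] from [y] inside [X], while [V] keeps [None] out of the
   closures. *)
- have [V chV GV] := sepG x.
  have /hS/contrapT[U [chU Uy]] : x <> y by move=> e; apply: xy; rewrite e.
  have GW : G (~` closure (U n `&` V n)).
    by apply: filterS GV; apply: subsetC; apply: closureS; apply: subIsetr.
  exists (fun i => extension_inj FG @` (U i `&` V i)); split.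
    exact: nbhs_chain_extension (nbhs_chainI chU chV) GW.
  apply/seteqP; split=> // _ [/(closure_extension_inj GW)[z clz <-] [zy]].
  have : set0 z; last by [].
  rewrite -Uy; split; last exact: zy.
  exact: (closureI clz).1.
- have [U chU GU] := sepG x.
  exists (fun i => extension_inj FG @` U i); split.
    exact: nbhs_chain_extension chU GU.
  by apply/seteqP; split=> // _ [/(closure_extension_inj GU)[z clz <-]].
- have [U chU GU] := sepG y.
  exists (fun i => ~` (extension_inj FG @` closure (U (n.+1 - i)))); split.
    exact: nbhs_chain_None chU GU.
  apply/seteqP; split=> // _ [/[swap] ->].
  (* The last set of the reversed chain comes from [U 1], an open neighborhood of [y]; hence [y] is
     outside its closure. *)
  have [oU1 U1y] : open_nbhs y (U 1) by apply: chU.1; rewrite leqnn.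
  rewrite subSnn closure_setC; apply.
  by apply: extension_inj_interior => //; exists y.
- by [].
Qed.

Lemma card_lt_le (T U V : Type) (A : set T) (B : set U) (C : set V) :
  A #<= B -> card_lt B C -> card_lt A C.
Proof.
move=> AB [BC nCB]; split; first exact: card_le_trans BC.
by move=> CA; apply: nCB; exact: card_le_trans AB.
Qed.

Lemma card_lt_finite (T U : Type) (A : set T) (B : set U) :
  finite_set A -> infinite_set B -> card_lt A B.
Proof.
move=> finA infB; split; last first.
  by move=> /card_le_finite /(_ finA) /infB.
have [m Am] := finA; move/infiniteP: infB; apply: card_le_trans.
by rewrite (card_le_eql Am) card_leT.
Qed.

Lemma regular_card_filter (T : Type) (F : set T) :
  regular_card F -> Filter [set W : set T | card_lt (F `\` W) F].
Proof.
move=> [infF regF]; split=> /=.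
- by rewrite setDT; apply: card_lt_finite.
- move=> A B ltA ltB; rewrite /= setDIr.
  (* Regularity speaks of indexed unions, so the two sets become a family over [bool], which is
     finite and hence smaller than [F]. *)
  have -> : F `\` A `|` F `\` B =
      \bigcup_(b in [set: bool]) (if b then F `\` A else F `\` B).
    apply/seteqP; split=> [x [?|?]|x [[] _ ?]]; [| |by left|by right].
      by exists true.
    by exists false.
  apply: regF => [|[] _ //]; exact: card_lt_finite.
- by move=> A B AB; apply: card_lt_le; apply: subset_card_le; exact: setDS.
Qed.

Theorem theorem3p4 (n : nat) (X : topologicalType) (hn : (1 <= n)%N)
    (hS : S_space n X) (hC : S_closed n X) : weakly_S_closed n X.
Proof.
move=> F infF regF; apply: contrapT => noacc.
set G := [set W : set X | card_lt (F `\` W) F].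
have FG : Filter G := regular_card_filter regF.
have G0 : ~ G set0 by rewrite /G /= setD0 => -[_]; apply.
apply: (range_extension_not_closed (FG := FG) G0).
apply: hC; last exact: extension_embedding.
apply: extension_S_space => // x.
(* If no chain at [x] is as required, then for every n-hull [V] of [x] the set [F]&[closure V] is
   not smaller than [F]. Being a subset of [F], it is equipotent to [F], so [x] is an accumulation
   point of the excluded kind. *)
apply: contrapT => noU; apply: noacc; exists x => V [U [chU UV]].
apply: contrapT => /negP nV; apply: noU; exists U => //.
rewrite UV /G /= setDE setCK.
split; first by apply: subset_card_le; exact: subIsetl.
move=> FV; move/negP: nV; apply; rewrite card_eq_le FV andbT.
by apply: subset_card_le; exact: subIsetl.
Qed.
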